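(* Let $A$ be a commutative $\mathbb Q$-algebra and let $a\in A$ be a non-zero-divisor such that the principal ideal $Aa$ is a radical ideal. Let $B=A[z]$ be the polynomial ring in one variable. Then the image of the $A$-linear map $\mathcal D=\partial_z-a:B\to B$ (i.e. $h\mapsto h'-ah$) is a Mathieu subspace of $B$ (as a $\mathbb Q$-algebra).
   Context: Let $k$ be a field and $R$ a commutative $k$-algebra. A $k$-vector subspace $\mathcal M\subseteq R$ is called a Mathieu subspace of $R$ if for every $f\in R$ the following holds: if $f^m\in\mathcal M$ for all $m\ge 1$, then for every $g\in R$ one has $f^mg\in\mathcal M$ for all sufficiently large $m$. *)

(* Defs.v *)
From HB Require Import structures.
From mathcomp Require Import all_boot all_order all_algebra.
Set Implicit Arguments. Unset Strict Implicit. Unset Printing Implicit Defensive.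
Import GRing.Theory.
Local Open Scope ring_scope.

(* A k-algebra R is a commutative ring R together with the structure ring
   morphism iota : k -> R; scalar multiplication is c * x := iota c * x. *)

Definition is_k_subspace (k : fieldType) (R : comNzRingType)
    (iota : {rmorphism k -> R}) (M : R -> Prop) : Prop :=
  M 0 /\ (forall x y, M x -> M y -> M (x + y)) /\
  (forall (c : k) x, M x -> M (iota c * x)).

Definition mathieu_subspace (k : fieldType) (R : comNzRingType)
    (iota : {rmorphism k -> R}) (M : R -> Prop) : Prop :=
  is_k_subspace iota M /\
  forall f : R, (forall m : nat, (1 <= m)%N -> M (f ^+ m)) ->
    forall g : R, exists N : nat, forall m : nat, (N <= m)%N -> M (f ^+ m * g).

Definition non_zero_divisor (A : comNzRingType) (a : A) : Prop :=
  forall x : A, x * a = 0 -> x = 0.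

Definition in_principal (A : comNzRingType) (a x : A) : Prop :=
  exists y : A, x = y * a.

Definition principal_radical (A : comNzRingType) (a : A) : Prop :=
  forall (x : A) (n : nat), in_principal a (x ^+ n) -> in_principal a x.

Definition polyQ (A : comAlgType rat) : {rmorphism rat -> {poly A}} :=
  (polyC \o in_alg A)%FUN.

Definition image_D (A : comAlgType rat) (a : A) (h : {poly A}) : Prop :=
  exists p : {poly A}, h = p^`() - a%:P * p.

(* Main.v *)
Require Import Defs.
From HB Require Import structures.
From mathcomp Require Import all_boot all_order all_algebra.
From mathcomp Require Import ring_quotient generic_quotient.
From mathcomp Require Import boolp classical_sets zify ring.
Set Implicit Arguments. Unset Strict Implicit. Unset Printing Implicit Defensive.
Import Order.TTheory GRing.Theory Num.Theory.
Local Open Scope ring_scope.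

(** Let E be the A-linear functional z^n |-> n! on A[z]. Solving h = p' - a p
    from the top coefficient down shows that, for deg h <= d, h lies in the
    image of D iff E(a^d h(z/a)) is divisible by a^(d+1).

    The heart of the matter is that E(g^m) in (a) for all m >= 1 forces
    g in aA[z]. Mapping A/(a), which is reduced, to fields of characteristic 0,
    this reduces to: E(g^m) = 0 for all m >= 1 implies g = 0 over such a field.
    If c is the lowest nonzero coefficient of g, then E(g^p) = 0 for a prime p
    gives c^p in pS, where S is the ring generated by the coefficients of g. So
    every prime is invertible in S[1/c], which is impossible for a nonzero
    finitely generated ring of characteristic 0.

    With d >= deg f, applying this repeatedly to a^d f(z/a) and dividing by a
    each time gives f(z/a) in aA[z], so that f^m g (z/a) is divisible by a as
    soon as m > deg g. *)

(** * Residue fields of a commutative ring *)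

(** [K] is the quotient by a maximal ideal containing [I], found by Zorn's lemma. *)
Lemma proper_ideal_field_quotient (R : comNzRingType) (I : R -> Prop) :
    I 0 -> (forall x y, I x -> I y -> I (x + y)) ->
    (forall r x, I x -> I (r * x)) -> ~ I 1 ->
  exists (K : fieldType) (phi : {rmorphism R -> K}), forall x, I x -> phi x = 0.
Proof.
move=> I0 ID IM I1.
(* Membership of 0 is left out so that the empty chain has an upper bound. *)
pose P (X : set R) := [/\ forall x y, X x -> X y -> X (x + y),
  forall r x, X x -> X (r * x), forall i x, I i -> X x -> X (i + x) & ~ X 1].
have [|J [[JD JM JI J1] Jmax]] := @Zorn_bigcup _ P.
  move=> F FP Ftot; split.
  - move=> x y [X FX Xx] [Y FY Yy]; case: (Ftot X Y FX FY) => sXY.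
      by exists Y => //; case: (FP _ FY) => YD _ _ _; apply: YD => //; apply: sXY.
    by exists X => //; case: (FP _ FX) => XD _ _ _; apply: XD => //; apply: sXY.
  - by move=> r x [X FX Xx]; exists X => //; case: (FP _ FX) => _ XM _ _; apply: XM.
  - by move=> i x Ii [X FX Xx]; exists X => //; case: (FP _ FX) => _ _ XI _; apply: XI.
  - by case=> X FX X1; case: (FP _ FX) => _ _ _; apply.
have [j Jj] : exists j, J j.
  apply: contrapT => J0; apply: (Jmax I); last by split=> //; move=> i x; apply: ID.
  split; first by move=> x Jx; case: J0; exists x.
  by move=> sIJ; case: J0; exists 0; apply: sIJ.
have J0 : J 0 by rewrite -(mul0r j); apply: JM.
have sIJ x : I x -> J x by move=> Ix; rewrite -[x]addr0; apply: JI.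
have Jinv x : ~ J x -> exists y, J (1 - y * x).
  move=> nJx; apply: contrapT => nex.
  (* [B] is the ideal J + Rx, strictly larger than [J]; if x had no inverse modulo [J], it would be
     proper. *)
  pose B : set R := fun z => exists u v, J u /\ z = u + v * x.
  apply: (Jmax B).
    split; first by move=> z Jz; exists z, 0; split=> //; rewrite mul0r addr0.
    move=> sBJ; apply: nJx; apply: sBJ; exists 0, 1; split=> //.
    by rewrite mul1r add0r.
  split.
  - move=> _ _ [u [v [Ju ->]]] [u' [v' [Ju' ->]]]; exists (u + u'), (v + v').
    by split; [apply: JD | rewrite mulrDl addrACA].
  - move=> r _ [u [v [Ju ->]]]; exists (r * u), (r * v).
    by split; [apply: JM | rewrite mulrDr mulrA].
  - move=> i _ Ii [u [v [Ju ->]]]; exists (i + u), v.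
    by split; [apply: JI | rewrite addrA].
  - by case=> u [v [Ju e1]]; apply: nex; exists v; rewrite e1 addrK.
pose S : {pred R} := fun x => `[< J x >].
have SP x : reflect (J x) (x \in S) by apply: asboolP.
have Sid : idealr_closed S.
  split; [exact/SP | exact/SP | ].
  by move=> r x y /SP Jx /SP Jy; apply/SP; apply: JD => //; apply: JM.
pose JS : idealr R := HB.pack S (isIdealr.Build R S Sid).
pose Q : comNzRingType := {ideal_quot JS}.
pose pi : {rmorphism R -> Q} := (\pi_({ideal_quot JS}))%qT.
have piP x : (pi x == 0) = (x \in S).
  by rewrite -(rmorph0 pi) -[LHS]Quotient.idealrBE subr0.
have Qinv (x : Q) : exists y : Q, if x == 0 then y = 0 else y * x = 1.
  case: eqP => [_|/eqP xN0]; first by exists 0.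
  have ex : x = pi (repr x) by rewrite /pi /= reprK.
  have /Jinv[y Jy] : ~ J (repr x) by move=> /SP; rewrite -piP -ex (negPf xN0).
  exists (pi y); rewrite ex -rmorphM; apply/eqP.
  by rewrite eq_sym -subr_eq0 -(rmorph1 pi) -rmorphB piP; apply/SP.
pose inv x := xget 0 (fun y : Q => if x == 0 then y = 0 else y * x = 1).
have invP x : if x == 0 then inv x = 0 else inv x * x = 1.
  by rewrite /inv; case: xgetP => [y -> //|]; case: (Qinv x) => y Hy /(_ y).
have mulVf (x : Q) : x != 0 -> inv x * x = 1.
  by move=> /negPf x0; have := invP x; rewrite x0.
have inv0 : inv 0 = 0 by have := invP 0; rewrite eqxx.
pose K : fieldType :=
  HB.pack (Quotient.quot JS) (GRing.ComNzRing_isField.Build Q mulVf inv0).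
by exists K, pi => x /sIJ /SP; rewrite -piP => /eqP.
Qed.

(** * Subrings of a field as images of morphisms, and integrality *)

(** The image is the subring phi(R)[g] of [K]; with g = 1/phi(u) it stands for the localization
    R[1/u]. *)
Definition eval_at (R : nzRingType) (K : comNzRingType)
    (phi : {rmorphism R -> K}) (g : K) : {rmorphism {poly R} -> K} :=
  horner_morph (fun x => mulrC g (phi x)).

Lemma eval_atE (R : nzRingType) (K : comNzRingType)
    (phi : {rmorphism R -> K}) (g : K) (p : {poly R}) :
  eval_at phi g p = (map_poly phi p).[g].
Proof. by []. Qed.

Lemma eval_atC (R : nzRingType) (K : comNzRingType)
    (phi : {rmorphism R -> K}) (g : K) (x : R) : eval_at phi g x%:P = phi x.
Proof. by rewrite eval_atE map_polyC hornerC. Qed.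

Lemma eval_atX (R : nzRingType) (K : comNzRingType)
    (phi : {rmorphism R -> K}) (g : K) : eval_at phi g 'X = g.
Proof. by rewrite eval_atE map_polyX hornerX. Qed.

Lemma clear_denominators (R : comNzRingType) (K : fieldType)
    (phi : {rmorphism R -> K}) (u : R) (p : {poly R}) (n : nat) :
  phi u != 0 -> (size p <= n.+1)%N ->
  exists c, phi u ^+ n * eval_at phi (phi u)^-1 p = phi c.
Proof.
move=> u0 sp; exists (\sum_(i < n.+1) p`_i * u ^+ (n - i)).
rewrite eval_atE (@horner_coef_wide _ n.+1) ?(leq_trans (size_poly _ _)) //.
rewrite mulr_sumr rmorph_sum; apply: eq_bigr => -[i /= ltin] _.
rewrite coef_map rmorphM rmorphXn /= mulrCA; congr (_ * _).
rewrite -[in X in X * _](subnK (ltin : (i <= n)%N)) exprD -mulrA -exprMn.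
by rewrite divff ?expr1n ?mulr1.
Qed.

(** Multiplying a monic equation of degree n+1 for 1/u by u^(n+1) gives 1 + u c = 0 with c in the
    image of [R]. *)
Lemma integral_inv_dvd (R : comNzRingType) (K : fieldType)
    (phi : {rmorphism R -> K}) (u : R) :
  phi u != 0 -> integralOver phi (phi u)^-1 -> exists v, phi u * phi v = 1.
Proof.
move=> u0 [p mon_p /rootP]; set n := (size p).-1.
have sp : size p = n.+1 by rewrite polySpred ?monic_neq0.
have pn : p`_n = 1 by have /monicP := mon_p; rewrite lead_coefE.
have -> : p = p - 'X^n + 'X^n by rewrite subrK.
have : (size (p - 'X^n)%R <= n)%N.
  apply/leq_sizeP => j; rewrite leq_eqVlt coefB coefXn => /predU1P[<-|ltnj].
    by rewrite pn eqxx subrr.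
  by rewrite nth_default ?sp // gtn_eqF // subr0.
move: (p - 'X^n) => q; case: n {sp pn} => [|n] sq.
  rewrite (eqP (_ : q == 0)) -?size_poly_leq0 // add0r expr0 rmorph1 hornerE => /eqP.
  by rewrite oner_eq0.
have [c ec] := clear_denominators u0 sq.
rewrite rmorphD /= map_polyXn hornerD hornerXn -eval_atE => e0.
exists (- c); rewrite rmorphN -ec mulrN mulrA -exprS; apply/eqP.
rewrite eq_sym -addr_eq0 -(mulr0 (phi u ^+ n.+1)) -e0 mulrDr addrC.
by rewrite -exprMn divff ?expr1n.
Qed.

Lemma integral_inv_dvd_power (R : comNzRingType) (K : fieldType)
    (phi : {rmorphism R -> K}) (r u : R) :
  phi r != 0 -> phi u != 0 ->
  integralOver (eval_at phi (phi r)^-1) (phi u)^-1 ->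
  exists j v, phi r ^+ j = phi u * phi v.
Proof.
move=> r0 u0 iu; have [||w] := @integral_inv_dvd _ _ (eval_at phi (phi r)^-1) u%:P.
- by rewrite eval_atC.
- by rewrite eval_atC.
rewrite eval_atC => uw.
have [c ec] := clear_denominators r0 (leqnSn (size w)).
by exists (size w), c; rewrite -ec mulrCA uw mulr1.
Qed.

Lemma integral_eval_at (R T K : comNzRingType) (phi : {rmorphism R -> K})
    (chi : {rmorphism T -> K}) (g : K) (p : {poly R}) :
  (forall x, integralOver chi (phi x)) -> integralOver chi g ->
  integralOver chi (eval_at phi g p).
Proof.
move=> iphi ig; rewrite eval_atE; apply: integral_horner => //.
by apply/integral_poly => i; rewrite coef_map; apply: iphi.
Qed.

Lemma integral_of_lead_coef_inv (R T : comNzRingType) (K : fieldType)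
    (phi : {rmorphism R -> K}) (chi : {rmorphism T -> K}) (g : K)
    (q : {poly R}) :
  map_poly phi q != 0 -> eval_at phi g q = 0 ->
  (forall x, integralOver chi (phi x)) ->
  integralOver chi (lead_coef (map_poly phi q))^-1 ->
  integralOver chi g.
Proof.
move=> q0 qg iphi ib; set b := lead_coef _ in ib.
have b0 : b != 0 by rewrite lead_coef_eq0.
apply: (@integral_root_monic _ _ chi g (b^-1 *: map_poly phi q)).
- by rewrite monicE lead_coefZ mulVf.
- by apply/rootP; rewrite hornerZ -eval_atE qg mulr0.
- apply/integral_poly => i; rewrite coefZ coef_map.
  by apply: integral_mul; last apply: iphi.
Qed.

(** * Descent of divisibility along finitely generated extensions *)

(** Dividing a monic equation of [s] by the largest possible power of X leaves c + s t = 0 with c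
    nonzero and t a polynomial in [s], so 1/s = -t/c. As [c] is fixed before [T], it can be inverted
    in a ring chosen afterwards. *)
Lemma integral_inv_over_localization (R : comNzRingType) (K : fieldType)
    (phi : {rmorphism R -> K}) (s : K) :
  s != 0 -> integralOver phi s ->
  exists2 c, phi c != 0 &
    forall (T : comNzRingType) (chi : {rmorphism T -> K}),
      (forall x, integralOver chi (phi x)) ->
      integralOver chi (phi c)^-1 -> integralOver chi s^-1.
Proof.
move=> s0 is_; have [p mon_p ps] := is_.
have [m [N]] := multiplicity_XsubC (map_poly phi p) 0.
rewrite monic_neq0 ?monic_map //= subr0 => N0 eN.
have eNi i : N`_i = phi p`_(i + m).
  by rewrite -coef_map eN coefMXn ltnNge leq_addl /= addnK.
have e0 : N`_0 = phi p`_m by rewrite eNi.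
exists p`_m; first by rewrite -e0 -horner_coef0.
have : root N s.
  by move: ps; rewrite eN rootM [root 'X^m s]rootE hornerXn expf_eq0
    (negPf s0) andbF orbF.
rewrite -{1}(poly_take_drop 1 N) => /rootP Ns T chi iphi ic.
have -> : s^-1 = - ((drop_poly 1 N).[s] * (phi p`_m)^-1).
  have eT : take_poly 1 N = (phi p`_m)%:P.
    by apply/polyP=> -[|i]; rewrite coef_take_poly coefC //= e0.
  move: Ns; rewrite eT hornerD hornerC hornerM hornerXn expr1 => /eqP.
  rewrite addrC addr_eq0 => /eqP Ns; have c0 : phi p`_m != 0.
    by rewrite -e0 -horner_coef0.
  by apply: (mulfI s0); rewrite mulfV // mulrN mulrCA mulrA Ns mulNr opprK divff.
apply/integral_opp/integral_mul => //; apply: integral_horner.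
  by apply/integral_poly=> i; rewrite coef_drop_poly eNi; apply: iphi.
apply: (integral_root_monic (monic_map _ mon_p) ps).
by apply/integral_poly=> i; rewrite coef_map; apply: iphi.
Qed.

(* If g is transcendental over the image of R, the leading coefficient of p
   works; otherwise R[g][1/s] is integral over R[1/r] for some r. *)
Lemma dvd_power_descent1 (R : comNzRingType) (K : fieldType)
    (phi : {rmorphism R -> K}) (g : K) (p : {poly R}) :
  eval_at phi g p != 0 ->
  exists2 r, phi r != 0 & forall u k q,
    eval_at phi g p ^+ k = phi u * eval_at phi g q ->
    exists j v, phi r ^+ j = phi u * phi v.
Proof.
(* The size is that of the image, since [phi] may kill the leading coefficient of [q]. *)
move=> pg0; pose lc (q : {poly R}) := q`_(size (map_poly phi q)).-1.
have lcE q : phi (lc q) = lead_coef (map_poly phi q).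
  by rewrite lead_coefE coef_map.
have [[q [q0 qg]]|gtr] :=
    pselect (exists q, map_poly phi q != 0 /\ eval_at phi g q = 0); last first.
  have p0 : map_poly phi p != 0.
    by apply: contraNneq pg0 => p0; rewrite eval_atE p0 horner0.
  exists (lc p); first by rewrite lcE lead_coef_eq0.
  (* By transcendence p^k = u q holds between the image polynomials; compare coefficients at the
     degree of p^k. *)
  move=> u k q epq; exists k, q`_(size (map_poly phi p ^+ k)).-1.
  have /eqP : map_poly phi (p ^+ k - u%:P * q) = 0.
    apply/eqP/negPn/negP => n0; apply: gtr; exists (p ^+ k - u%:P * q).
    by split=> //; rewrite rmorphB rmorphXn rmorphM eval_atC /= epq subrr.
  rewrite rmorphB rmorphXn rmorphM /= map_polyC subr_eq0 => /eqP ek.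
  by rewrite lcE -lead_coef_exp lead_coefE {1}ek coefCM coef_map.
set s := eval_at phi g p in pg0 *; pose b := lc q.
have b0 : phi b != 0 by rewrite lcE lead_coef_eq0.
pose chi0 := eval_at phi (phi b)^-1.
have i0 x : integralOver chi0 (phi x).
  by rewrite -(eval_atC phi (phi b)^-1); apply: integral_id.
have ib0 : integralOver chi0 (phi b)^-1.
  by rewrite -{1}(eval_atX phi (phi b)^-1); apply: integral_id.
have ig0 : integralOver chi0 g.
  by apply: integral_of_lead_coef_inv q0 qg i0 _; rewrite -lcE.
have [C C0 sinv] := integral_inv_over_localization pg0 (integral_eval_at p i0 ig0).
have [c ec] := clear_denominators b0 (leqnSn (size C)).
have c0 : phi c != 0 by rewrite -ec mulf_neq0 // expf_neq0.
have r0 : phi (b * c) != 0 by rewrite rmorphM mulf_neq0.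
(* Inverting bc inverts [b], which makes [g] integral, and the value of [C], which makes 1/s
   integral. *)
exists (b * c) => // u k y esy.
pose chi := eval_at phi (phi (b * c))^-1.
have i1 x : integralOver chi (phi x).
  by rewrite -(eval_atC phi (phi (b * c))^-1); apply: integral_id.
have ir : integralOver chi (phi (b * c))^-1.
  by rewrite -{1}(eval_atX phi (phi (b * c))^-1); apply: integral_id.
have ib : integralOver chi (phi b)^-1.
  have -> : (phi b)^-1 = phi c * (phi (b * c))^-1.
    by rewrite rmorphM invfM mulrCA divff ?mulr1.
  exact: integral_mul.
have ig : integralOver chi g.
  by apply: integral_of_lead_coef_inv q0 qg i1 _; rewrite -lcE.
have is1 : integralOver chi s^-1.
  apply: sinv => [x|]; first exact: integral_eval_at.
  have -> : (eval_at phi (phi b)^-1 C)^-1 = phi (b ^+ (size C).+1) * (phi (b * c))^-1.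
    rewrite [phi (b * c)]rmorphM -ec rmorphXn exprS invfM mulrACA divff // mul1r.
    by rewrite invfM mulrA divff ?mul1r // expf_neq0.
  exact: integral_mul.
have u0 : phi u != 0.
  by apply: contraNneq (expf_neq0 k pg0) => u0; rewrite esy u0 mul0r.
apply: integral_inv_dvd_power => //.
have -> : (phi u)^-1 = eval_at phi g y * s^-1 ^+ k.
  apply: (mulfI u0); rewrite divff // mulrA -esy -exprMn divff //.
  by rewrite expr1n.
apply: integral_mul; first exact: integral_eval_at.
by elim: k {esy} => [|k IH]; rewrite ?exprS; [exact: integral1 | exact: integral_mul].
Qed.

(** [S] stands for [R] with [gs] adjoined, one generator at a time. For the integers in a field of
    characteristic 0, this confines the primes that become invertible in S[1/s] to the divisors of
    one nonzero integer. *)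
Lemma dvd_power_descent (K : fieldType) (R : comNzRingType)
    (phi : {rmorphism R -> K}) (gs : seq K) :
  exists (S : comNzRingType) (psi : {rmorphism S -> K}),
    [/\ forall x, exists y, psi y = phi x,
        forall g, g \in gs -> exists y, psi y = g &
        forall s, psi s != 0 -> exists2 r, phi r != 0 & forall u k q,
          psi s ^+ k = phi u * psi q ->
          exists j v, phi r ^+ j = phi u * phi v].
Proof.
elim: gs => [|g gs IH] in R phi *.
  exists R, phi; split=> // [x|s s0]; first by exists x.
  by exists s => // u k q e; exists k, q.
have [S [psi [im_psi gs_psi desc]]] := IH _ (eval_at phi g).
exists S, psi; split.
- by move=> x; have [y ey] := im_psi x%:P; exists y; rewrite ey eval_atC.
- move=> h; rewrite inE => /predU1P[->|/gs_psi //].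
  by have [y ey] := im_psi 'X; exists y; rewrite ey eval_atX.
- move=> s /desc[p p0 descp]; have [r r0 descr] := dvd_power_descent1 p0.
  exists r => // u k q; rewrite -(eval_atC phi g) => /descp[j [v]].
  by rewrite eval_atC => /descr.
Qed.

(** * The factorial functional and its values on powers *)

(** Formally the integral of p(t) e^(-t) over t >= 0. *)
Definition fact_eval (R : nzRingType) (p : {poly R}) : R :=
  \sum_(i < size p) p`_i *+ i`!.

Lemma fact_eval_wide (R : nzRingType) (p : {poly R}) (n : nat) :
  (size p <= n)%N -> fact_eval p = \sum_(i < n) p`_i *+ i`!.
Proof.
move=> sp; rewrite /fact_eval (big_ord_widen n (fun i => p`_i *+ i`!) sp).
rewrite big_mkcond; apply: eq_bigr => i _; case: ltnP => // /(nth_default 0)->.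
by rewrite mul0rn.
Qed.

Lemma fact_evalD (R : nzRingType) (p q : {poly R}) :
  fact_eval (p + q) = fact_eval p + fact_eval q.
Proof.
pose n := maxn (size p) (size q).
rewrite !(@fact_eval_wide _ _ n) ?leq_maxl ?leq_maxr ?size_polyD // -big_split.
by apply: eq_bigr => i _; rewrite coefD mulrnDl.
Qed.

Lemma fact_evalZ (R : nzRingType) (c : R) (p : {poly R}) :
  fact_eval (c *: p) = c * fact_eval p.
Proof.
rewrite !(@fact_eval_wide _ _ (size p)) ?size_scale_leq // mulr_sumr.
by apply: eq_bigr => i _; rewrite coefZ mulrnAr.
Qed.

Lemma fact_eval_map (R S : nzRingType) (phi : {rmorphism R -> S}) (p : {poly R}) :
  fact_eval (map_poly phi p) = phi (fact_eval p).
Proof.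
rewrite (@fact_eval_wide _ _ (size p)) ?size_poly // rmorph_sum.
by apply: eq_bigr => i _; rewrite coef_map rmorphMn.
Qed.

Lemma fact_evalMXn (R : nzRingType) (p : {poly R}) (k n : nat) :
  (size p <= n)%N ->
  fact_eval (p * 'X^k) = \sum_(i < n) p`_i *+ (k + i)`!.
Proof.
move=> sp; rewrite (@fact_eval_wide _ _ (k + n)); last first.
  rewrite (leq_trans (size_polyMleq _ _)) // size_polyXn addnS /=.
  by rewrite addnC leq_add2l.
rewrite big_split_ord /= big1 ?add0r => [|i _]; last first.
  by rewrite coefMXn ltn_ord mul0rn.
by apply: eq_bigr => i _; rewrite coefMXn ltnNge leq_addr /= addKn.
Qed.

(* From (g ^+ p)^`() = p g ^+ p.-1 g^`() and the invertibility of n mod p. *)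
Lemma coef_exp_prime (R : comNzRingType) (g : {poly R}) (p n : nat) :
  prime p -> (0 < n < p)%N -> exists y, (g ^+ p)`_n = p%:R * y.
Proof.
move=> pr_p /andP[n0 ltnp]; set x := _`_n.
have [c ec] : exists c, x *+ n = p%:R * c.
  exists (g ^+ p.-1 * g^`())`_n.-1.
  have := coef_deriv (g ^+ p) n.-1; rewrite prednK // => <-.
  by rewrite deriv_exp coefMn mulr_natl mulrC.
case: (egcdnP p n0) => u v euv _.
have /eqP cop : gcdn n p == 1%N.
  by rewrite -/(coprime n p) coprime_sym prime_coprime // gtnNdvd.
(* Bezout's u n = v p + 1 gives x = u (n x) - v p x, and n x is a multiple of p. *)
exists (c *+ u - x *+ v).
have : x *+ (u * n) = x *+ (v * p) + x by rewrite euv cop mulrnDr.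
move/eqP; rewrite addrC -subr_eq => /eqP ex; rewrite -{1}ex.
rewrite mulrBr mulnC mulrnA ec mulrnAr; congr (_ - _).
by rewrite mulrnA mulr_natl.
Qed.

(** The constant term of g^p gives the first summand. For 0 < n < p the coefficient of z^n in g^p is
    a multiple of p; for n >= p the factor n!, which divides (rp+n)!/(rp)!, is one. *)
Lemma fact_eval_exp_prime (R : comNzRingType) (g : {poly R}) (r p : nat) :
  prime p -> exists q,
    fact_eval ((g * 'X^r) ^+ p) = ((r * p)`!)%:R * (g`_0 ^+ p + p%:R * q).
Proof.
move=> pr_p; rewrite exprMn -exprM; set k := (r * p)%N; set h := g ^+ p.
rewrite (fact_evalMXn _ (leqnSn (size h))) big_ord_recl addn0.
have -> : h`_0 = g`_0 ^+ p by rewrite -!horner_coef0 horner_exp.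
suff [q ->] : exists q,
    \sum_(i < size h) h`_(lift ord0 i) *+ (k + lift ord0 i)`! = k`!%:R * (p%:R * q).
  by exists q; rewrite mulrDr [X in _ = X + _]mulr_natl.
apply: (big_ind (fun z => exists q, z = k`!%:R * (p%:R * q))).
- by exists 0; rewrite !mulr0.
- by move=> _ _ [a ->] [b ->]; exists (a + b); rewrite !mulrDr.
move=> i _; set n := nat_of_ord (lift ord0 i).
have n0 : (0 < n)%N by [].
have [m ->] : exists m, (k + n)`! = (k`! * (n`! * m))%N.
  by exists 'C(k + n, n); rewrite -(@bin_fact (k + n) n) ?leq_addl // addnK; lia.
have [ltnp|lepn] := ltnP n p.
  have [|y ->] := @coef_exp_prime _ g p n pr_p; first by rewrite n0.
  by exists (y *+ (n`! * m)); rewrite mulrnA !mulrnAr [k`!%:R * _]mulr_natl.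
have /dvdnP[c ->] : (p %| n`!)%N by rewrite dvdn_fact ?prime_gt0.
exists (h`_n *+ (c * m)); rewrite mulr_natl mulr_natl -!mulrnA; congr (_ *+ _).
lia.
Qed.

(** Descent to the integers turns the lowest nonzero coefficient of [f] into a nonzero integer [b].
    Each prime p divides the p-th power of that coefficient in [S], hence divides [b], which is
    absurd. *)
Lemma fact_eval_powers_eq0 (K : fieldType) (f : {poly K}) :
  (forall n, n.+1%:R != 0 :> K) ->
  (forall m, (0 < m)%N -> fact_eval (f ^+ m) = 0) -> f = 0.
Proof.
move=> char0 fE; apply/eqP/negPn/negP => f0.
have natK n : (0 < n)%N -> n%:R != 0 :> K by case: n => // n _.
have [r [h]] := multiplicity_XsubC f 0; rewrite f0 /= subr0 => h0 ef.
have [S [psi [_ im_psi desc]]] := dvd_power_descent (intr : {rmorphism int -> K}) h.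
have [g eg] : exists g : {poly S}, map_poly psi g = h.
  have pre i : exists y, psi y = h`_i.
    have [lti|lei] := ltnP i (size h); first exact/im_psi/mem_nth.
    by exists 0; rewrite rmorph0 nth_default.
  have [G GE] := choice pre.
  exists (\poly_(i < size h) G i); apply/polyP => i; rewrite coef_map coef_poly.
  by case: ltnP => [_|lei]; [exact: GE | rewrite raddf0 nth_default].
have [|b b0 bP] := desc g`_0.
  by rewrite -coef_map eg -horner_coef0.
have bdvd p : prime p -> (p %| `|b|)%N.
  move=> pr_p; have [q eq] := fact_eval_exp_prime g r pr_p.
  have := fE p (prime_gt0 pr_p).
  have -> : f = map_poly psi (g * 'X^r) by rewrite rmorphM /= map_polyXn eg.
  rewrite -rmorphXn fact_eval_map eq rmorphM rmorph_nat => /eqP.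
  rewrite mulf_eq0 (negPf (natK _ (fact_gt0 _))) /=.
  rewrite rmorphD rmorphXn rmorphM rmorph_nat addr_eq0 -mulrN -rmorphN => /eqP.
  move/(bP p%:Z)=> [j [v]]; rewrite -rmorphXn -rmorphM /= => /eqP.
  rewrite -subr_eq0 -rmorphB /= => e0.
  have /eqP : b ^+ j - p%:Z * v = 0.
    case: (b ^+ j - _) e0 => [[//|n]|n] /=; first by rewrite (negPf (char0 n)).
    by rewrite NegzE rmorphN oppr_eq0 (negPf (char0 n)).
  rewrite subr_eq0 => /eqP /(congr1 absz).
  rewrite abszX abszM => ebj; have := dvdn_mulr `|v| (dvdnn p).
  by rewrite -ebj Euclid_dvdX // => /andP[].
have [p ltp pr_p] := prime_above `|b|.
suff b_gt0 : (0 < `|b|)%N by have := dvdn_leq b_gt0 (bdvd p pr_p); rewrite leqNgt ltp.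
by rewrite absz_gt0; apply: contraNneq b0 => ->; rewrite rmorph0.
Qed.

(** * From fields of characteristic 0 to radical principal ideals *)

Lemma algQ_morph_char0 (A : comAlgType rat) (K : fieldType)
    (phi : {rmorphism A -> K}) (n : nat) : n.+1%:R != 0 :> K.
Proof.
have e1 : n.+1%:R * in_alg A (n.+1%:R^-1) = 1.
  by rewrite -(rmorph_nat (in_alg A)) -rmorphM /= divff ?scale1r ?pnatr_eq0.
apply: contra_eq_neq (congr1 phi e1) => n0.
by rewrite rmorphM rmorph_nat n0 mul0r rmorph1 eq_sym oner_eq0.
Qed.

(* The field is a residue field of A[1/x] / (a), presented as a quotient of
   A['X] by an ideal containing a and x * 'X - 1. *)
Lemma radical_fact_eval (A : comAlgType rat) (a : A) (g : {poly A}) :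
  principal_radical a ->
  (forall m, (0 < m)%N -> in_principal a (fact_eval (g ^+ m))) ->
  forall i, in_principal a g`_i.
Proof.
move=> arad gE i; apply: contrapT; set x := g`_i => nax.
pose I (P : {poly A}) := exists U V, P = a%:P * U + (x%:P * 'X - 1) * V.
have [|||[U [V e1]]|K [phi phiI]] := @proper_ideal_field_quotient _ I.
- by exists 0, 0; rewrite !mulr0 addr0.
- move=> _ _ [U [V ->]] [U' [V' ->]]; exists (U + U'), (V + V'); ring.
- move=> r _ [U [V ->]]; exists (r * U), (r * V); ring.
(* Reading 1 = aU + (xX - 1)V coefficientwise gives V_j = -x^j modulo [a]; at the size of [V] this
   puts a power of x in (a). *)
- have aV j : in_principal a (V`_j + x ^+ j).
    elim: j => [|j [y IH]].
      have := congr1 (fun P : {poly A} => P`_0) e1.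
      rewrite coef1 coefD coefCM mulrBl mul1r coefB -mulrA coefCM coefXM mulr0.
      by rewrite sub0r expr0 => /= e; exists U`_0; rewrite [1]e; ring.
    have := congr1 (fun P : {poly A} => P`_j.+1) e1.
    rewrite coef1 coefD coefCM mulrBl mul1r coefB -mulrA coefCM coefXM /= => e.
    exists (U`_j.+1 + x * y); rewrite mulrDl -mulrA -IH.
    by move/esym/eqP: e; rewrite addrA subr_eq0 => /eqP <-; rewrite exprS; ring.
  apply: nax; apply: (arad _ (size V)).
  by have := aV (size V); rewrite nth_default // add0r.
pose psi : {rmorphism A -> K} := phi \o polyC.
have psia : psi a = 0.
  by apply: phiI; exists 1, 0; rewrite mulr1 mulr0 addr0.
(* This makes x invertible in the residue field, while the field case gives psi x = 0. *)
have : phi (x%:P * 'X - 1) = 0 by apply: phiI; exists 0, 1; rewrite mulr1 mulr0 add0r.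
rewrite rmorphB rmorphM rmorph1 -[phi x%:P]/(psi x) => /eqP.
have -> : psi x = 0.
  rewrite -coef_map (_ : map_poly psi g = 0) ?coef0 //.
  apply: fact_eval_powers_eq0 => [n|m m0]; first exact: algQ_morph_char0 psi n.
  have [y ey] := gE m m0.
  by rewrite -rmorphXn fact_eval_map ey rmorphM psia mulr0.
by rewrite mul0r sub0r oppr_eq0 oner_eq0.
Qed.

(** * Homogenization and membership in the image of D *)

Lemma non_zero_divisorX (A : comNzRingType) (a : A) (n : nat) :
  non_zero_divisor a -> non_zero_divisor (a ^+ n).
Proof.
move=> ha; elim: n => [|n IH] x; first by rewrite mulr1.
by rewrite exprSr mulrA => /ha /IH.
Qed.
Arguments non_zero_divisorX {A a} n ha.

Lemma non_zero_divisorI (A : comNzRingType) (a : A) :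
  non_zero_divisor a -> injective ( *%R^~ a).
Proof.
by move=> ha x y /eqP; rewrite -subr_eq0 -mulrBl => /eqP /ha /subr0_eq.
Qed.

(* a^d h(z/a); meaningful only for deg h <= d, since higher terms are dropped. *)
Definition homog (A : comNzRingType) (a : A) (d : nat) (h : {poly A}) : {poly A} :=
  \poly_(i < d.+1) (h`_i * a ^+ (d - i)).

Lemma coef_comp_scaleX (A : comNzRingType) (a : A) (p : {poly A}) (i : nat) :
  (p \Po (a *: 'X))`_i = p`_i * a ^+ i.
Proof.
have -> : p \Po (a *: 'X) = \poly_(j < size p) (p`_j * a ^+ j).
  rewrite comp_polyE poly_def; apply: eq_bigr => j _.
  by rewrite exprZn scalerA.
by rewrite coef_poly; case: ltnP => // /(nth_default 0)->; rewrite mul0r.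
Qed.

Lemma homog_compE (A : comNzRingType) (a : A) (d : nat) (h : {poly A}) :
  (size h <= d.+1)%N -> homog a d h \Po (a *: 'X) = a ^+ d *: h.
Proof.
move=> sh; apply/polyP => i; rewrite coef_comp_scaleX coef_poly coefZ.
case: ltnP => [lti|lei]; first by rewrite -mulrA -exprD subnK // mulrC.
by rewrite nth_default ?mulr0 ?mul0r // (leq_trans sh).
Qed.

(** Substituting aX for X turns both sides into a^(d+e) f g. The substitution multiplies the
    coefficient of X^i by a^i, so it is injective. *)
Lemma homogM (A : comNzRingType) (a : A) (d e : nat) (f g : {poly A}) :
  non_zero_divisor a -> (size f <= d.+1)%N -> (size g <= e.+1)%N ->
  homog a (d + e) (f * g) = homog a d f * homog a e g.
Proof.
move=> ha sf sg; apply/polyP => i.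
apply: (non_zero_divisorI (non_zero_divisorX i ha)) => /=.
rewrite -!coef_comp_scaleX rmorphM /= !homog_compE //.
  by rewrite -scalerAl -scalerAr scalerA -exprD.
rewrite (leq_trans (size_polyMleq _ _)) //; move: sf sg.
move: (size f) (size g) => m n; lia.
Qed.

Lemma size_exp_bound (A : comNzRingType) (f : {poly A}) (d m : nat) :
  (size f <= d.+1)%N -> (size (f ^+ m) <= (d * m).+1)%N.
Proof.
move=> sf; rewrite (leq_trans (size_poly_exp_leq _ _)) // ltnS leq_mul2r.
by rewrite -subn1 leq_subLR add1n sf orbT.
Qed.

Lemma homogX (A : comNzRingType) (a : A) (d m : nat) (f : {poly A}) :
  non_zero_divisor a -> (size f <= d.+1)%N ->
  homog a (d * m) (f ^+ m) = homog a d f ^+ m.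
Proof.
move=> ha sf; elim: m => [|m IH].
  rewrite muln0 !expr0; apply/polyP => i; rewrite coef_poly coef1.
  by case: i => [|i] //=; rewrite mulr1.
by rewrite !exprS mulnS homogM ?size_exp_bound // IH.
Qed.

Lemma fact_eval_homog (A : comNzRingType) (a : A) (d : nat) (h : {poly A}) :
  fact_eval (homog a d h) = \sum_(i < d.+1) h`_i * a ^+ (d - i) *+ i`!.
Proof.
rewrite (fact_eval_wide (size_poly _ _)); apply: eq_bigr => i _.
by rewrite coef_poly ltn_ord.
Qed.

(** With T_i = p_i a^(d+1-i) i! the sum telescopes to T_(d+1) - T_0, and T_(d+1) = 0 by the size
    bound. *)
Lemma fact_eval_homog_D (A : comNzRingType) (a : A) (d : nat) (p : {poly A}) :
  (size p <= d.+1)%N ->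
  fact_eval (homog a d (p^`() - a%:P * p)) = - (p`_0 * a ^+ d.+1).
Proof.
move=> sp; pose T i := p`_i * a ^+ (d.+1 - i) *+ i`!.
rewrite fact_eval_homog.
transitivity (\sum_(0 <= i < d.+1) (T i.+1 - T i)).
  rewrite big_mkord; apply: eq_bigr => -[i /= lti] _.
  rewrite /T coefB coef_deriv coefCM subSS subSn // exprS mulrBl mulrnBl.
  congr (_ - _); first by rewrite mulrnAl -mulrnA factS.
  by rewrite mulrA [p`_i * a]mulrC.
rewrite telescope_sumr // /T nth_default // mul0r mul0rn sub0r subn0 fact0.
by rewrite mulr1n.
Qed.

Lemma image_D_homog (A : comAlgType rat) (a : A) (d : nat) (h : {poly A}) :
  non_zero_divisor a -> (size h <= d.+1)%N ->
  image_D a h <-> in_principal (a ^+ d.+1) (fact_eval (homog a d h)).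
Proof.
move=> ha sh; split=> [[p eh]|[c]].
  exists (- p`_0); rewrite eh fact_eval_homog_D ?mulNr //.
  (* The degree of p is at most that of h: as [a] is a non-zero-divisor, the top coefficient of a p
     is nonzero, and p' cannot cancel it. *)
  rewrite (leq_trans _ sh) //; have [->|p0] := eqVneq p 0; first by rewrite size_poly0.
  rewrite (polySpred p0) ltnNge; apply/negP => /leq_sizeP /(_ _ (leqnn _)).
  rewrite eh coefB coef_deriv coefCM [p`__.+1]nth_default -?polySpred //.
  rewrite mul0rn sub0r mulrC => /eqP; rewrite oppr_eq0 => /eqP /ha /eqP.
  by rewrite -lead_coefE lead_coef_eq0 (negPf p0).
elim: d h sh c => [|d IH] h sh c.
  rewrite fact_eval_homog big_ord1 expr1 fact0 mulr1 mulr1n => e0.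
  exists (- c%:P); rewrite derivN derivC oppr0 sub0r mulrN opprK -polyCM mulrC -e0.
  exact: size1_polyC.
rewrite fact_eval_homog big_ord_recr /= subnn mulr1 => ec.
(* Modulo [a] only the term (d+1)! h_(d+1) of the sum survives, and (d+1)! is invertible in a
   Q-algebra. *)
have [e eh] : exists e, h`_d.+1 = a * e.
  have [y ey] : exists y, h`_d.+1 *+ (d.+1)`! = a * y.
    move/eqP: ec; rewrite eq_sym addrC -subr_eq => /eqP <-.
    suff [y ->] : exists y,
      \sum_(i < d.+1) h`_i * a ^+ (d.+1 - i) *+ i`! = a * y.
      by exists (c * a ^+ d.+1 - y); rewrite exprS; ring.
    exists (\sum_(i < d.+1) h`_i * a ^+ (d - i) *+ i`!).
    rewrite mulr_sumr; apply: eq_bigr => -[i /= lti] _.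
    by rewrite subSn // exprS mulrnAr mulrCA.
  exists ((((d.+1)`!)%:R^-1 : rat) *: y); rewrite -scalerAr -ey -scaler_nat.
  by rewrite scalerA mulVf ?scale1r // pnatr_eq0 -lt0n fact_gt0.
(* Adding D(q) cancels the top coefficient: it becomes h_(d+1) - a e = 0. *)
pose q := e *: 'X^(d.+1); pose h1 := h + (q^`() - a%:P * q).
have sh1 : (size h1 <= d.+1)%N.
  apply/leq_sizeP => j; rewrite leq_eqVlt coefD coefB coef_deriv coefCM !coefZ !coefXn.
  case/predU1P=> [<-|ltj].
    by rewrite eqxx gtn_eqF ?ltnS // mulr0 mul0rn eh mulr1 sub0r subrr.
  have -> : (j.+1 == d.+1) = false by lia.
  have -> : (j == d.+1) = false by lia.
  by rewrite nth_default ?(leq_trans sh) // !mulr0 mul0rn subr0 addr0.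
(* Homogenizing [h1] in degree d+1 instead of d multiplies the functional by [a]; D(q) contributes
   -q_0 a^(d+2). *)
have [|p ep] := IH h1 sh1 (c - q`_0).
  apply: (non_zero_divisorI ha) => /=.
  have -> : fact_eval (homog a d h1) * a = fact_eval (homog a d.+1 h1).
    rewrite !fact_eval_homog [RHS]big_ord_recr /= [h1`_d.+1]nth_default //.
    rewrite mul0r mul0rn addr0 mulr_suml; apply: eq_bigr => -[i /= lti] _.
    by rewrite subSn // exprSr mulrA mulrnAl.
  have -> : homog a d.+1 h1 = homog a d.+1 h + homog a d.+1 (q^`() - a%:P * q).
    apply/polyP => i; rewrite coefD !coef_poly coefD mulrDl.
    by case: ifP => // _; rewrite addr0.
  rewrite fact_evalD fact_eval_homog_D; last first.
    by rewrite (leq_trans (size_scale_leq _ _)) // size_polyXn.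
  rewrite fact_eval_homog big_ord_recr /= subnn mulr1 ec -mulrA -exprSr.
  by rewrite mulrBl.
exists (p - q); rewrite derivB mulrBr.
have -> : h = h1 - (q^`() - a%:P * q) by rewrite addrK.
by rewrite ep; ring.
Qed.

(** * The Mathieu property of the image *)

Theorem theorem2p8 (A : comAlgType rat) (a : A)
    (ha : non_zero_divisor a) (hrad : principal_radical a) :
  mathieu_subspace (polyQ A) (image_D a).
Proof.
split.
  split; first by exists 0; rewrite linear0 mulr0 subr0.
  split=> [_ _ [p ->] [q ->]|c _ [p ->]].
    by exists (p + q); rewrite derivD; ring.
  exists (polyQ A c * p); rewrite [polyQ A c]/(in_alg A c)%:P deriv_mulC.
  by rewrite mulrBr mulrCA.
(* Sizes in place of degrees spare the case of a zero polynomial. *)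
move=> f fD g; pose d := size f; pose e := size g.
have sf : (size f <= d.+1)%N by [].
have sg : (size g <= e.+1)%N by [].
have [h eh] : exists h, homog a d f = a ^+ d.+1 *: h.
  suff /(_ d.+1 (leqnn _)) : forall k, (k <= d.+1)%N ->
    exists h, homog a d f = a ^+ k *: h by [].
  elim=> [|k IH] ltk; first by exists (homog a d f); rewrite scale1r.
  have [h eh] := IH (ltnW ltk).
  have /choice[Y EY] : forall i, in_principal a h`_i.
    apply: radical_fact_eval => // m m0.
    have /(image_D_homog ha (size_exp_bound m sf))[c] := fD m m0.
    rewrite homogX // eh exprZn fact_evalZ -exprM mulrC => ec.
    (* Since k <= d, a^(dm+1) = a^(km) a^((d-k)m) a; cancelling a^(km) leaves E(h^m) divisible by
       [a]. *)
    exists (c * a ^+ ((d - k) * m)).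
    apply: (non_zero_divisorI (non_zero_divisorX (k * m) ha)) => /=.
    rewrite ec -!mulrA -exprS -exprD; congr (_ * _ ^+ _).
    by rewrite addnS -mulnDl subnK.
  exists (\poly_(i < size h) Y i); rewrite eh exprSr -scalerA; congr (_ *: _).
  apply/polyP => i; rewrite coefZ coef_poly mulrC.
  by case: ltnP => [_|/(nth_default 0)->]; rewrite ?EY // mul0r.
(* f^m g homogenizes to a multiple of a^((d+1)m), and (d+1)m >= dm + e + 1 exactly when m >= e +
   1. *)
exists e.+1 => m ltem.
have sfg : (size (f ^+ m * g)%R <= (d * m + e).+1)%N.
  apply: (leq_trans (size_polyMleq _ _)).
  rewrite -subn1 leq_subLR add1n -addnS -addSn.
  exact: leq_add (size_exp_bound m sf) sg.
apply/(image_D_homog ha sfg); rewrite homogM ?size_exp_bound // homogX // eh.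
rewrite exprZn -scalerAl fact_evalZ -exprM.
exists (a ^+ (m - e.+1) * fact_eval (h ^+ m * homog a e g)).
rewrite mulrAC -exprD; congr (_ ^+ _ * _); lia.
Qed.
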